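(* Let $\mathbb T^3=(\mathbb R/2\pi\mathbb Z)^3$ with coordinates $(x,y,z)$, let $Z=\{z=0\}\cup\{z=\pi\}$, and let $g=dx^2+dy^2+\frac{dz^2}{\sin^2 z}$ be the globally flat $b$-metric on $(\mathbb T^3,Z)$. Let $X$ be a $b$-Beltrami vector field on $(\mathbb T^3,Z,g)$ that is globally symmetric, i.e. $[X,\sin z\,\partial_z]=0$ on the whole of $\mathbb T^3$, and that is not identically zero on $Z$. Then $X$ has at least two singular periodic orbits.
   Context: A $b$-vector field on $(M,Z)$ is a vector field on $M$ tangent to the hypersurface $Z$; these are the sections of the $b$-tangent bundle ${}^bTM$, and a $b$-metric is a positive-definite symmetric bilinear form on ${}^bTM$. Here ${}^bTM$ for $(\mathbb T^3,Z)$ is spanned by $\partial_x,\partial_y,\sin z\,\partial_z$, and the $b$-volume form of $g$ is $\mu_g=dx\wedge dy\wedge\frac{dz}{\sin z}$. A $b$-Beltrami vector field on $(M,Z,g)$ is a $b$-vector field $X$ with $\operatorname{curl}X=\lambda X$ for some nonzero constant $\lambda$, the curl being computed with respect to $g$; equivalently $d\big(g(X,\cdot)\big)=\lambda\,\iota_X\mu_g$. A singular periodic orbit of $X$ is an integral curve $\gamma:\mathbb R\to M\setminus Z$ of $X$ such that $\lim_{t\to\pm\infty}\gamma(t)=p_\pm\in Z$ with $X(p_\pm)=0$ (as a vector field on $M$). *)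

(* Defs.v *)
From HB Require Import structures.
From mathcomp Require Import all_boot all_order all_algebra.
From mathcomp Require Import all_classical all_reals all_analysis.

Set Implicit Arguments.
Unset Strict Implicit.
Unset Printing Implicit Defensive.

Import Order.TTheory GRing.Theory Num.Theory.
Import numFieldNormedType.Exports.

Local Open Scope classical_set_scope.
Local Open Scope quotient_scope.
Local Open Scope ring_scope.

Definition eq_mod2pi (R : realType) (a b : R) : bool :=
  `[< exists k : int, a - b = k%:~R * (2 * pi) >].

Lemma eq_mod2pi_refl (R : realType) : reflexive (@eq_mod2pi R).
Proof. by move=> a; apply/asboolP; exists 0; rewrite subrr mul0r. Qed.

Lemma eq_mod2pi_sym (R : realType) : symmetric (@eq_mod2pi R).
Proof.
have H (a b : R) : eq_mod2pi a b -> eq_mod2pi b a.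
  move=> /asboolP[k abk]; apply/asboolP; exists (- k).
  by rewrite -opprB abk mulrNz mulNr.
by move=> a b; apply/idP/idP; apply: H.
Qed.

Lemma eq_mod2pi_trans (R : realType) : transitive (@eq_mod2pi R).
Proof.
move=> b a c /asboolP[k abk] /asboolP[l bcl]; apply/asboolP; exists (k + l).
by rewrite mulrzDr mulrDl -abk -bcl addrA subrK.
Qed.

Canonical eq_mod2pi_equiv (R : realType) :=
  EquivRel (@eq_mod2pi R) (@eq_mod2pi_refl R) (@eq_mod2pi_sym R)
    (@eq_mod2pi_trans R).

Definition circle (R : realType) :=
  quotient_topology {eq_quot (@eq_mod2pi_equiv R)}.
HB.instance Definition _ (R : realType) := Topological.on (circle R).
HB.instance Definition _ (R : realType) := Quotient.on (circle R).

Definition angle (R : realType) (a : R) : circle R := \pi_(circle R) a.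

Lemma angleP (R : realType) (a b : R) :
  angle a = angle b <-> exists k : int, a - b = k%:~R * (2 * pi).
Proof.
have E : reflect (angle a = angle b) (eq_mod2pi a b).
  exact: (eqmodP (eq_mod2pi_equiv R) a b).
by split=> [/E/asboolP|/asboolP/E].
Qed.

Definition torus3 (R : realType) : Type := (circle R * circle R * circle R)%type.
HB.instance Definition _ (R : realType) := Topological.on (torus3 R).

(* The indices 0, 1, 2 of a triple stand for x, y, z. *)
Definition ix : 'I_3 := @Ordinal 3 0 isT.
Definition iy : 'I_3 := @Ordinal 3 1 isT.
Definition iz : 'I_3 := @Ordinal 3 2 isT.

Definition torus_proj (R : realType) (u : 'rV[R]_3) : torus3 R :=
  (angle (u 0 ix), angle (u 0 iy), angle (u 0 iz)).

Definition Zhyp (R : realType) : set (torus3 R) :=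
  [set p | p.2 = angle 0 \/ p.2 = angle pi].

(* Calculus in the global coordinates (x, y, z), i.e. on the universal cover
   R^3 of the torus. *)

Definition coord_vec (R : realType) (i : 'I_3) : 'rV[R]_3 := delta_mx 0 i.

Definition partial (R : realType) (i : 'I_3) (f : 'rV[R]_3 -> R)
  (u : 'rV[R]_3) : R := 'D_(coord_vec R i) f u.

Fixpoint Ck (R : realType) (k : nat) (f : 'rV[R]_3 -> R) : Prop :=
  if k is k'.+1 then
    forall i, (forall u, derivable f u (coord_vec R i)) /\ Ck k' (partial i f)
  else continuous f.

Definition smooth (R : realType) (f : 'rV[R]_3 -> R) : Prop :=
  forall k, Ck k f.

(* A vector field on T^3 is given by its components in the global frame
   (d/dx, d/dy, d/dz). *)
Definition vfield (R : realType) := torus3 R -> 'rV[R]_3.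

Definition lift_vf (R : realType) (X : vfield R) (u : 'rV[R]_3) : 'rV[R]_3 :=
  X (torus_proj u).

Definition smooth_vf (R : realType) (X : vfield R) : Prop :=
  forall i, smooth (fun u => lift_vf X u 0 i).

Definition b_vector_field (R : realType) (X : vfield R) : Prop :=
  smooth_vf X /\ forall p, Zhyp p -> X p 0 iz = 0.

Definition bracket (R : realType) (V W : 'rV[R]_3 -> 'rV[R]_3)
  (u : 'rV[R]_3) : 'rV[R]_3 :=
  \row_i \sum_j (V u 0 j * partial j (fun w => W w 0 i) u
                 - W u 0 j * partial j (fun w => V w 0 i) u).

Definition sin_z_dz (R : realType) (u : 'rV[R]_3) : 'rV[R]_3 :=
  sin (u 0 iz) *: coord_vec R iz.

Definition globally_symmetric (R : realType) (X : vfield R) : Prop :=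
  forall u, bracket (lift_vf X) (@sin_z_dz R) u = 0.

(* g = dx^2 + dy^2 + dz^2 / sin^2 z at the point u, on ordinary tangent
   vectors; meaningful for sin z <> 0. *)
Definition bmetric (R : realType) (u v w : 'rV[R]_3) : R :=
  v 0 ix * w 0 ix + v 0 iy * w 0 iy
  + v 0 iz * w 0 iz / sin (u 0 iz) ^+ 2.

(* mu_g = dx /\ dy /\ dz / sin z at the point u; meaningful for sin z <> 0. *)
Definition bvolume (R : realType) (u v0 v1 v2 : 'rV[R]_3) : R :=
  \det (\matrix_(i < 3) [:: v0; v1; v2]`_i) / sin (u 0 iz).

Definition flat (R : realType) (X : vfield R) (u : 'rV[R]_3) : 'rV[R]_3 :=
  \row_i bmetric u (lift_vf X u) (coord_vec R i).

(* (d a)(d/dx_i, d/dx_j) for a 1-form a given by its components. *)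
Definition ext_d (R : realType) (a : 'rV[R]_3 -> 'rV[R]_3) (u : 'rV[R]_3)
  (i j : 'I_3) : R :=
  partial i (fun w => a w 0 j) u - partial j (fun w => a w 0 i) u.

(* curl X = Y, i.e. d (g(X, .)) = iota_Y mu_g.  A smooth b-form is determined
   by its restriction to the dense open set M \ Z, where it is an ordinary form
   and where the b-differential is the ordinary d, so for b-vector fields the
   identity of b-forms on M is the identity of ordinary forms on M \ Z. *)
Definition is_curl (R : realType) (X Y : vfield R) : Prop :=
  forall u, ~ Zhyp (torus_proj u) -> forall i j,
    ext_d (flat X) u i j
    = bvolume u (lift_vf Y u) (coord_vec R i) (coord_vec R j).

Definition b_Beltrami (R : realType) (X : vfield R) : Prop :=
  b_vector_field X /\
  exists lambda : R, lambda != 0 /\ is_curl X (fun p => lambda *: X p).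

(* The derivative of a curve in T^3 is that of a lift to R^3; every continuous
   curve R -> T^3 has one. *)
Definition integral_curve (R : realType) (X : vfield R) (gamma : R -> torus3 R)
  : Prop :=
  exists c : R -> 'rV[R]_3,
    (forall t, gamma t = torus_proj (c t)) /\
    (forall t, is_derive t (1 : R) c (X (gamma t))).

Definition singular_periodic_orbit (R : realType) (X : vfield R)
  (gamma : R -> torus3 R) : Prop :=
  [/\ integral_curve X gamma,
      forall t, ~ Zhyp (gamma t),
      exists p : torus3 R, [/\ gamma t @[t --> +oo] --> p, Zhyp p & X p = 0] &
      exists p : torus3 R, [/\ gamma t @[t --> -oo] --> p, Zhyp p & X p = 0]].

(* Main.v *)
Require Import Defs.
From mathcomp Require Import all_boot all_order all_algebra.
From mathcomp Require Import all_classical all_reals all_analysis.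
From mathcomp Require Import ring lra.

Set Implicit Arguments.
Unset Strict Implicit.
Unset Printing Implicit Defensive.

Import Order.TTheory GRing.Theory Num.Theory.
Import numFieldNormedType.Exports.

Local Open Scope classical_set_scope.
Local Open Scope ring_scope.

(** The field is determined on each slab a < z < a + pi, for a = 0 or a = pi,
    by one function H of (x, y).  Commuting with sin z d/dz forces the x- and
    y-components of X to be independent of z on the slab and the z-component to
    be H(x, y) sin z ([horizontal_const], [vertical_profile]).  The metric dual
    of X is then X1 dx + X2 dy + H dz / sin z, and the dz-components of the
    Beltrami equation read dH/dx = - lambda X2 and dH/dy = lambda X1
    ([beltrami_gradient]).  So

      X = (H_y / lambda, - H_x / lambda, H sin z):

    above a critical point of H the field is vertical, and it vanishes there on
    the two bounding tori z = a and z = a + pi.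

    If H vanished identically, X would vanish on the whole closed slab, whose
    boundary projects onto Z; this is excluded by the hypothesis on X.  Hence
    the maximum of H^2 on the compact torus is positive and is attained at a
    critical point (x0, y0) of H with H(x0, y0) <> 0 ([slab_crit]).  The
    vertical segment above (x0, y0) is invariant, and z' = H(x0, y0) sin z is
    solved on it by a shifted Gudermannian function, which runs from one
    bounding torus to the other ([slab_orbit]).

    The two slabs are disjoint, so each contributes its own orbit.

    On a slab H is represented, up to sign, by the z-component of X on the
    middle torus z = a + pi / 2, where sin z = 1 or -1. *)

(** * Angles *)

Lemma sin_int_period (R : realType) (k : int) (b : R) :
  sin (k%:~R * (2 * pi) + b) = sin b.
Proof.
have pos (n : nat) (c : R) : sin (c + n%:R * (2 * pi)) = sin c.
  have -> : n%:R * (2 * pi) = (pi *+ 2) *+ n :> R.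
    by rewrite -[RHS]mulr_natl -[pi *+ 2]mulr_natl.
  exact: (periodicn (@sinD2pi R)).
case: (intP k) => [|n|n].
- by rewrite mul0r add0r.
- by rewrite addrC -pmulrn pos.
- rewrite -[LHS](pos n.+1); congr sin.
  by rewrite mulrNz -pmulrn mulNr addrC addrA subrr add0r.
Qed.

Lemma sin_angle (R : realType) (a b : R) : angle a = angle b -> sin a = sin b.
Proof. by move=> /angleP[k abk]; rewrite -(subrK b a) abk sin_int_period. Qed.

Lemma angle_continuous (R : realType) : continuous (@angle R).
Proof. exact: pi_continuous. Qed.

Lemma angle2pi (R : realType) : angle (pi + pi : R) = angle 0.
Proof. by apply/angleP; exists 1; rewrite subr0 mul1r mulr_natl mulr2n. Qed.

Lemma angle_surj (R : realType) (q : circle R) : exists a, q = angle a.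
Proof. by exists (repr q); rewrite /angle reprK. Qed.

Lemma angle_period_repr (R : realType) (a : R) :
  exists2 b, 0 <= b <= 2 * pi & angle b = angle a.
Proof.
have pi2 : 0 < 2 * pi :> R by rewrite mulr_gt0 ?pi_gt0.
set k := Num.floor (a / (2 * pi)).
exists (a - k%:~R * (2 * pi)); last first.
  by apply/angleP; exists (- k); rewrite addrAC subrr sub0r mulrNz mulNr.
have /andP[h1 h2] := floor_itv (a / (2 * pi)).
move: h1 h2.
rewrite -/k intrD ler_pdivlMr// ltr_pdivrMr// mulrDl mul1r => h1 h2.
by apply/andP; split; lra.
Qed.

(** * The connecting solution of w' = k sin w *)

(** The Gudermannian function shifted by pi / 2, so that it increases from 0 at
    -oo to pi at +oo; it solves w' = sin w. *)
Definition gud (R : realType) (s : R) : R := 2 * atan (expR s).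

Lemma gud_itv (R : realType) (s : R) : 0 < gud s < pi.
Proof.
have h1 : atan (expR s) < pi / 2 := atan_ltpi2 _.
have h2 : 0 < atan (expR s) by rewrite -(@atan0 R) lt_atan// expR_gt0.
by rewrite /gud; apply/andP; split; lra.
Qed.

Lemma is_derive_gud (R : realType) (s : R) :
  is_derive s 1 (@gud R) (sin (gud s)).
Proof.
have H : is_derive s 1 (@atan R \o @expR R) ((1 + expR s ^+ 2)^-1 * expR s).
  exact: is_derive1_comp.
apply: is_derive_eq; rewrite /gud /= [2 * atan _]mulr_natl sin_mulr2n.
set x := expR s; set t := atan x.
have n0 : 1 + x ^+ 2 != 0 by rewrite gt_eqF// ltr_wpDr ?sqr_ge0.
have c2 : cos t ^+ 2 = (1 + x ^+ 2)^-1.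
  by rewrite cos_atan exprVn sqr_sqrtr// addr_ge0 ?sqr_ge0.
have c0 : cos t != 0 by rewrite -sqrf_eq0 c2 invr_eq0.
have -> : sin t = x * cos t.
  by rewrite -{1}(atanK x) -/t /tan divfK.
by rewrite mulrCA -expr2 c2 -mulr_natl /GRing.scale/= ; ring.
Qed.

Lemma cvgy_gud (R : realType) : @gud R s @[s --> +oo] --> pi.
Proof.
have -> : pi = 2 * (pi / 2) :> R by field.
apply: cvgMl_tmp.
suff : @expR R s @[s --> +oo] --> +oo.
  by move=> /cvg_comp; apply; exact: cvgy_atan.
apply: (@ger_cvgy R _ _ _ (fun s => 1 + s) _ _ (cvg_addrl 1)).
by near=> s; exact: expR_ge1Dx.
Unshelve. all: by end_near. Qed.

Lemma cvgNy_gud (R : realType) : @gud R s @[s --> -oo] --> 0.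
Proof.
have H : atan (expR (- s)) @[s --> +oo%R] --> @atan R 0.
  exact: (cvg_comp _ _ (@cvgr_expR R) (@continuous_atan R 0)).
have {H} : gud (- s) @[s --> +oo%R] --> 2 * @atan R 0 by exact: cvgMl_tmp.
by rewrite atan0 mulr0 => /(cvgNy_compNP (@gud R)).
Qed.

(** Which endpoint is reached at +oo depends on the sign of k, but a singular
    periodic orbit only asks for a zero at either end, so the sign is
    forgotten here. *)
Lemma gud_heteroclinic (R : realType) (a k : R) : k != 0 -> exists b b',
  [/\ (b = a \/ b = a + pi), (b' = a \/ b' = a + pi),
      a + gud (k * t) @[t --> +oo] --> b &
      a + gud (k * t) @[t --> -oo] --> b'].
Proof.
have pos (l : R) : 0 < l ->
    (a + gud (l * t) @[t --> +oo] --> a + pi) /\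
    (a + gud (l * t) @[t --> -oo] --> a).
  move=> l0; split.
    have lt : l * t @[t --> +oo] --> +oo by exact: gt0_cvgMry.
    have := cvg_comp _ _ lt (@cvgy_gud R).
    by apply: cvgD; exact: cvg_cst.
  have lt : l * t @[t --> -oo] --> -oo by exact: gt0_cvgMrNy.
  have := cvg_comp _ _ lt (@cvgNy_gud R).
  by rewrite -{2}[a]addr0; apply: cvgD; exact: cvg_cst.
move=> k0; have [kneg|kpos|keq] := ltgtP k 0.
- have [c c'] := pos (- k) ltac:(by rewrite oppr_gt0).
  exists a, (a + pi); split; [by left|by right| |].
  + have -> : (fun t => a + gud (k * t)) = (fun t => a + gud (- k * t)) \o -%R.
      by apply/funext => t /=; rewrite mulrNN.
    exact/(cvgNy_compNP (fun t => a + gud (- k * t))).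
  + apply/(cvgNy_compNP (fun t => a + gud (k * t))).
    have -> : (fun t => a + gud (k * t)) \o -%R = (fun t => a + gud (- k * t)).
      by apply/funext => t /=; rewrite mulrN mulNr.
    exact: c.
- have [c c'] := pos k kpos.
  by exists (a + pi), a; split; [right|left| |].
- by rewrite keq eqxx in k0.
Qed.

(** * Calculus along coordinate lines *)

Definition pt (R : realType) (x y z : R) : 'rV[R]_3 := \row_i [:: x; y; z]`_i.

Lemma pt_eta (R : realType) (u : 'rV[R]_3) : u = pt (u 0 ix) (u 0 iy) (u 0 iz).
Proof.
by apply/rowP => i; rewrite mxE; case: i => -[|[|[|//]]] i3; congr (u _ _);
  exact/val_inj.
Qed.

Lemma ptE (R : realType) (x y z : R) :
  (pt x y z 0 ix = x) * (pt x y z 0 iy = y) * (pt x y z 0 iz = z).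
Proof. by rewrite !mxE. Qed.

Lemma torus_proj_pt (R : realType) (x y z : R) :
  torus_proj (pt x y z) = (angle x, angle y, angle z).
Proof. by rewrite /torus_proj !ptE. Qed.

Lemma pt000 (R : realType) : pt 0 0 0 = 0 :> 'rV[R]_3.
Proof. by apply/rowP => i; rewrite !mxE; case: i => -[|[|[|//]]]. Qed.

Lemma pt00 (R : realType) (z : R) : pt 0 0 z = z *: coord_vec R iz.
Proof.
by apply/rowP => i; rewrite !mxE; case: i => -[|[|[|//]]] i3 /=;
  rewrite ?mulr0 ?mulr1.
Qed.

(** The difference quotient of f at c s in the direction v is the
    difference quotient of f \o c at s, so directional derivatives reduce to
    derivatives of functions of one real variable. *)
Lemma derive_line (R : realType) (f : 'rV[R]_3 -> R) (v : 'rV[R]_3)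
    (c : R -> 'rV[R]_3) (s : R) :
  (forall h, c (h + s) = h *: v + c s) ->
  (derivable f (c s) v -> derivable (f \o c) s 1) /\
  'D_v f (c s) = 'D_1 (f \o c) s.
Proof.
move=> cE; rewrite /derivable /derive.
suff -> : (fun h : R => h^-1 *: ((f \o shift (c s)) (h *: v) - f (c s))) =
          (fun h : R =>
             h^-1 *: (((f \o c) \o shift s) (h *: (1 : R)) - (f \o c) s)) by [].
by apply/funext => h /=; rewrite -cE [h *: _]mulr1.
Qed.

Lemma pt_shift (R : realType) (x y z h : R) :
  (pt (h + x) y z = h *: coord_vec R ix + pt x y z) *
  (pt x (h + y) z = h *: coord_vec R iy + pt x y z) *
  (pt x y (h + z) = h *: coord_vec R iz + pt x y z).
Proof.
by do !split; apply/rowP => i; rewrite !mxE;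
  case: i => -[|[|[|//]]] i3 /=; rewrite ?mulr1 ?mulr0 ?add0r.
Qed.

Lemma partialE (R : realType) (f : 'rV[R]_3 -> R) (x y z : R) :
  (partial ix f (pt x y z) = 'D_1 (fun t => f (pt t y z)) x) *
  (partial iy f (pt x y z) = 'D_1 (fun t => f (pt x t z)) y) *
  (partial iz f (pt x y z) = 'D_1 (fun t => f (pt x y t)) z).
Proof.
do !split.
- by apply: (derive_line f (c := fun t => pt t y z) _).2 => h; rewrite pt_shift.
- by apply: (derive_line f (c := fun t => pt x t z) _).2 => h; rewrite pt_shift.
- by apply: (derive_line f (c := fun t => pt x y t) _).2 => h; rewrite pt_shift.
Qed.

Lemma derivable_lines (R : realType) (f : 'rV[R]_3 -> R) (x y z : R) :
  (forall i u, derivable f u (coord_vec R i)) ->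
  [/\ derivable (fun t => f (pt t y z)) x 1,
      derivable (fun t => f (pt x t z)) y 1 &
      derivable (fun t => f (pt x y t)) z 1].
Proof.
move=> df; split.
- by apply: (derive_line f (c := fun t => pt t y z) _).1 => [h|];
    rewrite ?pt_shift.
- by apply: (derive_line f (c := fun t => pt x t z) _).1 => [h|];
    rewrite ?pt_shift.
- by apply: (derive_line f (c := fun t => pt x y t) _).1 => [h|];
    rewrite ?pt_shift.
Qed.

Lemma eq_of_derive0 (R : realType) (f : R -> R) (a b s t : R) :
  (forall r, a <= r <= b -> derivable f r 1) ->
  (forall r, a < r < b -> 'D_1 f r = 0) ->
  a <= s <= b -> a <= t <= b -> f s = f t.
Proof.
move=> df f0.
wlog st : s t / s <= t.
  by move=> H hs ht; case: (leP s t) => [|/ltW] st; [|symmetry]; exact: H.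
move=> /andP[as_ sb] /andP[at_ tb].
move: st; rewrite le_eqVlt => /predU1P[->//|st].
have [||r] := @MVT R f (fun r => 'D_1 f r) s t st.
- move=> r; rewrite in_itv/= => /andP[sr rt]; apply/derivableP/df.
  by rewrite (le_trans as_ (ltW sr)) (le_trans (ltW rt) tb).
- apply: derivable_within_continuous => r; rewrite in_itv/= => /andP[sr rt].
  by apply: df; rewrite (le_trans as_ sr) (le_trans rt tb).
- rewrite in_itv/= => /andP[sr rt].
  rewrite f0 ?mul0r; last by rewrite (le_lt_trans as_ sr) (lt_le_trans rt tb).
  by move/eqP; rewrite subr_eq0 => /eqP.
Qed.

Lemma det3_frame (R : realType) (v : 'rV[R]_3) :
  (\det (\matrix_(i < 3) [:: v; coord_vec R ix; coord_vec R iz]`_i)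
   = - v 0 iy) *
  (\det (\matrix_(i < 3) [:: v; coord_vec R iy; coord_vec R iz]`_i) = v 0 ix).
Proof.
split; rewrite (expand_det_row _ ord0) !big_ord_recl big_ord0 /cofactor;
  rewrite !(expand_det_row _ ord0) !big_ord_recl !big_ord0 /cofactor !det_mx11;
  rewrite !mxE /= /bump /= !(mul0r, mulr0, addr0, add0r, mulr1, mul1r).
- have -> : lift ord0 ord0 = iy by exact/val_inj.
  by rewrite expr1 mulrN1.
- have -> : ord0 = ix by exact/val_inj.
  by [].
Qed.

(** The slice at height z is a torus; it is reached through the fundamental
    square, a compact set to which every point can be translated. *)
Lemma periodic_max (R : realType) (f : 'rV[R]_3 -> R) (z : R) :
  continuous f ->
  (forall u v, torus_proj u = torus_proj v -> f u = f v) ->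
  exists x0 y0, forall x y, f (pt x y z) <= f (pt x0 y0 z).
Proof.
move=> cf pf.
pose I (i : 'I_3) : set R := nth set0
  [:: `[0, 2 * pi]%classic; `[0, 2 * pi]%classic; `[z, z]%classic] i.
have cA : compact [set v : 'rV[R]_3 | forall i, I i (v 0 i)].
  by apply: rV_compact => -[[|[|[|//]]] i3]; exact: segment_compact.
have A0 : [set v : 'rV[R]_3 | forall i, I i (v 0 i)] !=set0.
  exists (pt 0 0 z) => -[[|[|[|//]]] i3]; rewrite /I mxE /= in_itv/= ?lexx//.
    by rewrite mulr_ge0 ?pi_ge0.
  by rewrite mulr_ge0 ?pi_ge0.
have [u uA umax] := EVT_max_rV A0 cA (continuous_subspaceT cf).
exists (u 0 ix), (u 0 iy) => x y.
have uz : u 0 iz = z.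
  by move: uA; rewrite inE => /(_ iz); rewrite /I /= in_itv/= -eq_le => /eqP.
rewrite -[in leRHS]uz -pt_eta.
have [x' x'I xx'] := angle_period_repr x.
have [y' y'I yy'] := angle_period_repr y.
rewrite (pf _ (pt x' y' z)); last by rewrite !torus_proj_pt xx' yy'.
apply: umax; rewrite inE => -[[|[|[|//]]] i3];
  by rewrite /I mxE /= in_itv/= ?lexx.
Qed.

Lemma derive_at_max (R : realType) (f : R -> R) (s : R) :
  (forall t, derivable f t 1) -> (forall t, f t <= f s) -> 'D_1 f s = 0.
Proof.
move=> df fs.
have ss : s - 1 <= s + 1 by lra.
have sI : s \in `]s - 1, s + 1[ by rewrite in_itv/=; apply/andP; split; lra.
have H : is_derive s 1 f 0.
  by apply: (derive1_at_max ss _ sI) => t _; [exact: df|exact: fs].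
by rewrite derive_val.
Qed.

(** * The symmetry and Beltrami equations in coordinates *)

Lemma sum_ord3 (R : realType) (F : 'I_3 -> R) :
  \sum_j F j = F ix + F iy + F iz.
Proof.
rewrite !big_ord_recl big_ord0 addr0 addrA.
by congr (F _ + F _ + F _); exact/val_inj.
Qed.

Lemma bracket_sin_z_dz (R : realType) (V : 'rV[R]_3 -> 'rV[R]_3) (x y z : R) :
  let b := bracket V (@sin_z_dz R) (pt x y z) in
  [/\ b 0 ix = - (sin z * 'D_1 (fun t => V (pt x y t) 0 ix) z),
      b 0 iy = - (sin z * 'D_1 (fun t => V (pt x y t) 0 iy) z) &
      b 0 iz = V (pt x y z) 0 iz * cos z
               - sin z * 'D_1 (fun t => V (pt x y t) 0 iz) z].
Proof.
have sx (w : 'rV[R]_3) : sin_z_dz w 0 ix = 0 by rewrite !mxE/= mulr0.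
have sy (w : 'rV[R]_3) : sin_z_dz w 0 iy = 0 by rewrite !mxE/= mulr0.
have sz (w : 'rV[R]_3) : sin_z_dz w 0 iz = sin (w 0 iz).
  by rewrite !mxE/= mulr1.
have dx j : partial j (fun w => sin_z_dz w 0 ix) (pt x y z) = 0.
  by rewrite (funext sx) /partial derive_cst.
have dy j : partial j (fun w => sin_z_dz w 0 iy) (pt x y z) = 0.
  by rewrite (funext sy) /partial derive_cst.
have dzx : partial ix (fun w => sin_z_dz w 0 iz) (pt x y z) = 0.
  rewrite (funext sz) partialE -[RHS](derive_cst (sin z) x 1).
  by congr ('D_1 _ x); apply/funext => t; rewrite ptE.
have dzy : partial iy (fun w => sin_z_dz w 0 iz) (pt x y z) = 0.
  rewrite (funext sz) partialE -[RHS](derive_cst (sin z) y 1).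
  by congr ('D_1 _ y); apply/funext => t; rewrite ptE.
have dzz : partial iz (fun w => sin_z_dz w 0 iz) (pt x y z) = cos z.
  rewrite (funext sz) partialE -[RHS](@derive_val _ _ _ z 1 sin).
  by congr ('D_1 _ z); apply/funext => t; rewrite ptE.
split; rewrite mxE sum_ord3 ?dx ?dy ?dzx ?dzy ?dzz !sx !sy !sz ptE !partialE;
  ring.
Qed.

(** At the heights where sin z ^+ 2 = 1 the factor of the metric in front of
    dz^2 is 1, and it is constant along the x- and y-lines, so it disappears
    from these two components of the exterior derivative. *)
Lemma ext_d_flat (R : realType) (X : vfield R) (x y z : R) :
  sin z ^+ 2 = 1 ->
  let e := ext_d (flat X) (pt x y z) in
  let X' := fun u i => lift_vf X u 0 i in
  e ix iz = 'D_1 (fun t => X' (pt t y z) iz) x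
            - 'D_1 (fun t => X' (pt x y t) ix) z /\
  e iy iz = 'D_1 (fun t => X' (pt x t z) iz) y
            - 'D_1 (fun t => X' (pt x y t) iy) z.
Proof.
move=> s1 /=.
have fx u : flat X u 0 ix = lift_vf X u 0 ix.
  by rewrite mxE /bmetric !mxE/= !mulr0 mulr1 mul0r !addr0.
have fy u : flat X u 0 iy = lift_vf X u 0 iy.
  by rewrite mxE /bmetric !mxE/= !mulr0 mulr1 mul0r add0r !addr0.
have fz u : flat X u 0 iz = lift_vf X u 0 iz / sin (u 0 iz) ^+ 2.
  by rewrite mxE /bmetric !mxE/= !mulr0 mulr1 !add0r.
rewrite /ext_d !partialE; split; congr (_ - _).
- by congr ('D_1 _ x); apply/funext => t; rewrite fz ptE s1 divr1.
- by congr ('D_1 _ z); apply/funext => t; rewrite fx.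
- by congr ('D_1 _ y); apply/funext => t; rewrite fz ptE s1 divr1.
- by congr ('D_1 _ z); apply/funext => t; rewrite fy.
Qed.

Lemma bvolume_frame (R : realType) (v : 'rV[R]_3) (x y z : R) :
  bvolume (pt x y z) v (coord_vec R ix) (coord_vec R iz) = - v 0 iy / sin z /\
  bvolume (pt x y z) v (coord_vec R iy) (coord_vec R iz) = v 0 ix / sin z.
Proof. by rewrite /bvolume !det3_frame ptE. Qed.

Lemma sin_neq0_notZ (R : realType) (x y z : R) :
  sin z != 0 -> ~ Zhyp (torus_proj (pt x y z)).
Proof.
move=> /eqP sz; rewrite torus_proj_pt => -[] /= /sin_angle.
  by rewrite sin0.
by rewrite sinpi.
Qed.

(** On the middle torus of a slab X1 and X2 have no z-derivative, and the
    dx dz- and dy dz-components of the Beltrami equation express the gradient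
    of the z-component of X through the horizontal components of X. *)
Lemma beltrami_gradient (R : realType) (X : vfield R) (lambda : R) (x y z : R) :
  is_curl X (fun p => lambda *: X p) -> globally_symmetric X ->
  sin z ^+ 2 = 1 ->
  'D_1 (fun t => lift_vf X (pt t y z) 0 iz) x
    = - lambda * lift_vf X (pt x y z) 0 iy / sin z /\
  'D_1 (fun t => lift_vf X (pt x t z) 0 iz) y
    = lambda * lift_vf X (pt x y z) 0 ix / sin z.
Proof.
move=> hc hs s1.
have s0 : sin z != 0 by rewrite -sqrf_eq0 s1 oner_eq0.
have [bx by_ _] := bracket_sin_z_dz (lift_vf X) x y z.
move: bx by_; rewrite hs !mxE => /esym/eqP + /esym/eqP.
rewrite !oppr_eq0 !mulf_eq0 (negPf s0) /= => /eqP dx0 /eqP dy0.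
have [ex ey] := ext_d_flat X x y s1.
move: ex ey; rewrite !(hc _ (sin_neq0_notZ s0)) dx0 dy0 !subr0 => <- <-.
set Y := lift_vf (fun p => lambda *: X p) (pt x y z).
have [-> ->] := bvolume_frame Y x y z.
by rewrite /Y /lift_vf !mxE !mulNr.
Qed.

(** * The field on a slab *)

Lemma sin_slab (R : realType) (a w : R) :
  sin a = 0 -> sin (a + w) = cos a * sin w.
Proof. by move=> sa; rewrite sinD sa mul0r add0r. Qed.

Lemma cos_slab (R : realType) (a : R) : sin a = 0 -> cos a != 0.
Proof. by move=> /sin0cos1 ca; rewrite -normr_gt0 ca. Qed.

Lemma sin_slab_neq0 (R : realType) (a z : R) :
  sin a = 0 -> a < z < a + pi -> sin z != 0.
Proof.
move=> sa /andP[az za]; rewrite -[z](subrKC a) sin_slab// mulf_neq0 ?cos_slab//.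
by rewrite gt_eqF// sin_gt0_pi//; apply/andP; split; lra.
Qed.

Lemma sin_slab_mid (R : realType) (a : R) :
  sin a = 0 -> sin (a + pi / 2) ^+ 2 = 1.
Proof.
by move=> sa; rewrite sinDpihalf -real_normK ?num_real// sin0cos1 ?expr1n.
Qed.

Section slab.
Variables (R : realType) (X : vfield R) (a : R).
Hypotheses (smX : smooth_vf X) (symX : globally_symmetric X) (sa : sin a = 0).

Let dX x y z i : derivable (fun t => lift_vf X (pt x y t) 0 i) z 1.
Proof.
by have [] := @derivable_lines R (fun u => lift_vf X u 0 i) x y z
  (fun j u => ((smX i 1%N) j).1 u).
Qed.

(** Inside the slab the z-derivatives vanish because sin z does not; the closed
    slab, hence Z, is reached by continuity. *)
Lemma horizontal_const x y z : a <= z <= a + pi ->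
  lift_vf X (pt x y z) 0 ix = lift_vf X (pt x y (a + pi / 2)) 0 ix /\
  lift_vf X (pt x y z) 0 iy = lift_vf X (pt x y (a + pi / 2)) 0 iy.
Proof.
move=> hz; have p0 := pi_gt0 R.
have hc : a <= a + pi / 2 <= a + pi by apply/andP; split; lra.
have D0 r : a < r < a + pi ->
    'D_1 (fun t => lift_vf X (pt x y t) 0 ix) r = 0 /\
    'D_1 (fun t => lift_vf X (pt x y t) 0 iy) r = 0.
  move=> /(sin_slab_neq0 sa) s0.
  have [bx by_ _] := bracket_sin_z_dz (lift_vf X) x y r.
  move: bx by_; rewrite symX !mxE => /esym/eqP + /esym/eqP.
  by rewrite !oppr_eq0 !mulf_eq0 (negPf s0) /= => /eqP -> /eqP ->.
split;
  apply: (eq_of_derive0 (f := fun t => lift_vf X (pt x y t) 0 _) _ _ hz hc).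
- by move=> r _; exact: dX.
- by move=> r /D0[].
- by move=> r _; exact: dX.
- by move=> r /D0[].
Qed.

(** The z-component f satisfies f cos z = f' sin z, so f / sin z is constant
    along z-lines; its value is read off at the middle height. *)
Lemma vertical_profile x y z : a < z < a + pi ->
  lift_vf X (pt x y z) 0 iz =
  lift_vf X (pt x y (a + pi / 2)) 0 iz / sin (a + pi / 2) * sin z.
Proof.
move=> hz; have p0 := pi_gt0 R; set c := a + pi / 2.
have hc : a < c < a + pi by rewrite /c; apply/andP; split; lra.
set f := fun t => lift_vf X (pt x y t) 0 iz.
set g : R -> R := f * (fun t => (sin t)^-1).
have dg r : a < r < a + pi -> is_derive r 1 g 0.
  move=> /(sin_slab_neq0 sa) s0.
  have df : is_derive r 1 f ('D_1 f r) by exact/derivableP/dX.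
  have dV : is_derive r 1 (fun t : R => (sin t)^-1) (- (sin r) ^- 2 *: cos r).
    exact: is_deriveV.
  have [_ _] := bracket_sin_z_dz (lift_vf X) x y r.
  rewrite symX mxE => /esym/eqP; rewrite subr_eq0 => /eqP H.
  apply: is_derive_eq; rewrite -/f.
  have -> : 'D_1 f r = f r * cos r / sin r by rewrite /f H mulrAC mulfV// mul1r.
  by rewrite /GRing.scale/=; field.
suff : g z = g c by rewrite /g /= /f => /(congr1 ( *%R^~ (sin z))) <-;
  rewrite divfK// (sin_slab_neq0 sa).
have [az za] := andP hz; have [ac ca] := andP hc.
have sub r : Num.min z c <= r <= Num.max z c -> a < r < a + pi.
  rewrite ge_min le_max => /andP[/orP[] h1 /orP[] h2];
    by apply/andP; split; lra.
apply: (@eq_of_derive0 R g (Num.min z c) (Num.max z c)).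
- by move=> r /sub/dg dr; exact: ex_derive.
- move=> r /andP[/ltW h1 /ltW h2]; have dr : is_derive r 1 g 0.
    by apply/dg/sub; rewrite h1.
  by rewrite derive_val.
- by rewrite ge_min le_max !lexx.
- by rewrite ge_min le_max !lexx !orbT.
Qed.

End slab.

(** * Nonvanishing critical points *)

(** Each closed slab meets both components of Z, because a + 2 pi and a have the
    same angle. *)
Lemma Z_lift (R : realType) (a : R) (p : torus3 R) :
  a = 0 \/ a = pi -> Zhyp p ->
  exists x y z, [/\ p = torus_proj (pt x y z) & a <= z <= a + pi].
Proof.
case: p => -[p1 p2] p3 ha /= hp; have p0 := pi_gt0 R.
have [x ->] := angle_surj p1; have [y ->] := angle_surj p2.
have [z zp hz] : exists2 z, p3 = angle z & a <= z <= a + pi.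
  case: ha hp => -> [] /= ->.
  - by exists 0 => //; rewrite lexx add0r ltW.
  - by exists pi => //; rewrite add0r lexx ltW.
  - by exists (pi + pi); [rewrite angle2pi | rewrite lexx andbT lerDl ltW].
  - by exists pi => //; rewrite lexx lerDl ltW.
by exists x, y, z; split => //; rewrite torus_proj_pt zp.
Qed.

(** Maximising the square of the z-component, rather than the component itself,
    yields a critical point at which it does not vanish. *)
Lemma slab_crit (R : realType) (X : vfield R) (a : R) :
  b_Beltrami X -> globally_symmetric X ->
  (exists p, Zhyp p /\ X p <> 0) ->
  a = 0 \/ a = pi ->
  exists x0 y0, let v := lift_vf X (pt x0 y0 (a + pi / 2)) in
    [/\ v 0 ix = 0, v 0 iy = 0 & v 0 iz != 0].
Proof.
move=> [[smX X3Z] [lambda [l0 curlX]]] symX [p [Zp Xp]] ha.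
have sa : sin a = 0 by case: ha => ->; rewrite ?sin0 ?sinpi.
set c := a + pi / 2.
have s1 : sin c ^+ 2 = 1 by exact: sin_slab_mid.
have s0 : sin c != 0 by rewrite -sqrf_eq0 s1 oner_eq0.
pose f u := lift_vf X u 0 iz.
have X120 x y : 'D_1 (fun t => f (pt t y c)) x = 0 ->
    'D_1 (fun t => f (pt x t c)) y = 0 ->
    lift_vf X (pt x y c) 0 ix = 0 /\ lift_vf X (pt x y c) 0 iy = 0.
  have [-> ->] := beltrami_gradient x y curlX symX s1.
  move=> /eqP + /eqP; rewrite !mulf_eq0 oppr_eq0 invr_eq0 (negPf l0) (negPf s0).
  by rewrite !orbF /= => /eqP -> /eqP ->.
have df x y : derivable (fun t => f (pt t y c)) x 1 /\
              derivable (fun t => f (pt x t c)) y 1.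
  by have [] := @derivable_lines R f x y c (fun j u => ((smX iz 1%N) j).1 u).
have cf : continuous f := smX iz 0%N.
have [x0 [y0 fmax]] : exists x0 y0, forall x y,
    f (pt x y c) ^+ 2 <= f (pt x0 y0 c) ^+ 2.
  apply: (@periodic_max R (fun u => f u ^+ 2)).
    by move=> u; exact: (cvg_comp _ _ (cf u) (@exprn_continuous R 2 _)).
  by move=> u v uv; rewrite /f /lift_vf uv.
have f0 : f (pt x0 y0 c) != 0.
  apply/eqP => f0; apply: Xp.
  have fz x y : f (pt x y c) = 0.
    have := fmax x y; rewrite f0 expr0n /= => f2.
    by apply/eqP; rewrite -sqrf_eq0 eq_le f2 sqr_ge0.
  have [x [y [z [pE hz]]]] := Z_lift ha Zp.
  have [ex ey] := horizontal_const smX symX sa x y hz.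
  have [||vx vy] := X120 x y.
  - by rewrite -[RHS](derive_cst (0 : R) x 1); congr ('D_1 _ x); apply/funext.
  - by rewrite -[RHS](derive_cst (0 : R) y 1); congr ('D_1 _ y); apply/funext.
  rewrite [X p]pt_eta X3Z//.
  by move: ex ey; rewrite vx vy /lift_vf -pE => -> ->; rewrite pt000.
exists x0, y0 => /=.
(* From (g ^+ 2)' = 2 g g' = 0 and g s != 0. *)
have crit (g : R -> R) s : (forall t, derivable g t 1) ->
    (forall t, g t ^+ 2 <= g s ^+ 2) -> g s != 0 -> 'D_1 g s = 0.
  move=> dg gmax gs0.
  have dgs : is_derive s 1 g ('D_1 g s) by exact/derivableP.
  have := @derive_at_max R (g ^+ 2) s _ gmax.
  rewrite derive_val.
  have /[swap] /[apply] : forall t, derivable (g ^+ 2) t 1.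
    by move=> t; exact/derivableX.
  move=> /eqP; rewrite /GRing.scale /= !mulf_eq0 pnatr_eq0 /= expr1.
  by rewrite (negPf gs0) /= => /eqP.
have [||vx vy] := X120 x0 y0 _ _; last by split.
- by apply: (crit (fun t => f (pt t y0 c))) => // t; exact: (df t y0).1.
- by apply: (crit (fun t => f (pt x0 t c))) => // t; exact: (df x0 t).2.
Qed.

(** * Singular periodic orbits *)

Lemma torus_proj_cvg (R : realType) (F : set_system R) (FF : Filter F)
    (x y l : R) (w : R -> R) :
  w t @[t --> F] --> l ->
  torus_proj (pt x y (w t)) @[t --> F] --> torus_proj (pt x y l).
Proof.
move=> wl; rewrite torus_proj_pt.
under eq_fun do rewrite torus_proj_pt.
have cz : angle (w t) @[t --> F] --> angle l.
  exact: (cvg_comp _ _ wl (@angle_continuous R l)).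
have cxy : (fun=> (angle x, angle y)) @ F --> (angle x, angle y).
  exact: cvg_cst.
exact: (cvg_pair cxy cz).
Qed.

(** The last clause locates the orbit in the open slab, which is what tells the
    orbits of the two slabs apart. *)
Lemma slab_orbit (R : realType) (X : vfield R) (a : R) :
  b_Beltrami X -> globally_symmetric X ->
  (exists p, Zhyp p /\ X p <> 0) ->
  a = 0 \/ a = pi ->
  exists gamma, singular_periodic_orbit X gamma /\
    forall t, exists2 z, a < z < a + pi & (gamma t).2 = angle z.
Proof.
move=> bX symX nzX ha.
have [x0 [y0 []]] := slab_crit bX symX nzX ha.
have [[smX X3Z] _] := bX.
have sa : sin a = 0 by case: ha => ->; rewrite ?sin0 ?sinpi.
have p0 := pi_gt0 R.
set c := a + pi / 2 => vx vy vz.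
have hc : a <= c <= a + pi by rewrite /c; apply/andP; split; lra.
have sc : sin c = cos a by rewrite /c sinDpihalf.
have ca := cos_slab sa.
set h := lift_vf X (pt x0 y0 c) 0 iz / sin c.
have h0 : h != 0 by rewrite /h mulf_neq0 ?invr_eq0 ?sc.
have X0 z : a <= z <= a + pi ->
    lift_vf X (pt x0 y0 z) 0 ix = 0 /\ lift_vf X (pt x0 y0 z) 0 iy = 0.
  by move=> /(horizontal_const smX symX sa x0 y0); rewrite vx vy.
have XE z : a < z < a + pi ->
    lift_vf X (pt x0 y0 z) = (h * sin z) *: coord_vec R iz.
  move=> hz; have [|ex ey] := X0 z.
    by have /andP[/ltW -> /ltW ->] := hz.
  by rewrite [LHS]pt_eta ex ey (vertical_profile smX symX sa)// pt00.
(* sin (a + w) = cos a * sin w, so the rate changes by cos a = 1 or -1. *)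
pose k := h * cos a.
have k0 : k != 0 by rewrite mulf_neq0.
pose w t := a + gud (k * t).
have wI t : a < w t < a + pi.
  by have /andP[g1 g2] := gud_itv (k * t); rewrite /w; apply/andP; split; lra.
have dw (t : R) : is_derive t 1 w (h * sin (w t)).
  have dk : is_derive t 1 (fun t : R => k * t) k.
    by apply: is_derive_eq; rewrite /GRing.scale/= mulr1.
  have dg : is_derive t 1 (@gud R \o (fun t => k * t)) (sin (gud (k * t)) * k).
    by apply: is_derive1_comp; exact: is_derive_gud.
  rewrite sin_slab//.
  have : is_derive t 1 (cst a + (@gud R \o (fun t => k * t)))
      (0 + sin (gud (k * t)) * k).
    exact: is_deriveD.
  by move=> /is_derive_eq; apply; rewrite /k; ring.
have Zend b : b = a \/ b = a + pi ->
    Zhyp (torus_proj (pt x0 y0 b)) /\ X (torus_proj (pt x0 y0 b)) = 0.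
  move=> hb; have Zb : Zhyp (torus_proj (pt x0 y0 b)).
    rewrite torus_proj_pt; case: hb => ->; case: ha => ->;
      by rewrite /Zhyp /= ?add0r ?angle2pi; by [left|right].
  split => //.
  have [|ex ey] := X0 b; first by case: hb => ->; apply/andP; split; lra.
  by rewrite [LHS]pt_eta X3Z// ex ey pt000.
exists (fun t => torus_proj (pt x0 y0 (w t))); split; last first.
  by move=> t; exists (w t) => //; rewrite torus_proj_pt.
have [b [b' [hb hb' cb cb']]] := gud_heteroclinic a k0.
split.
- exists (fun t => pt x0 y0 (w t)); split => // t.
  rewrite -[X _]/(lift_vf X _) XE//.
  set dc := _ *: _.
  have dcoord (j : 'I_3) :
      is_derive t 1 (fun t : R => pt x0 y0 (w t) 0 j) (dc 0 j).
    rewrite !mxE; case: j => -[|[|[|//]]] j3.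
    - have -> : (fun t => pt x0 y0 (w t) 0 (Ordinal j3)) = cst x0.
        by apply/funext => s; rewrite mxE.
      by rewrite mulr0; exact: is_derive_cst.
    - have -> : (fun t => pt x0 y0 (w t) 0 (Ordinal j3)) = cst y0.
        by apply/funext => s; rewrite mxE.
      by rewrite mulr0; exact: is_derive_cst.
    - have -> : (fun t => pt x0 y0 (w t) 0 (Ordinal j3)) = w.
        by apply/funext => s; rewrite mxE.
      by rewrite mulr1.
  have dp : derivable (fun t : R => pt x0 y0 (w t)) t 1.
    by apply/derivable_mxP => i j; rewrite ord1; exact: ex_derive.
  apply: DeriveDef => //; rewrite derive_mx//.
  by apply/rowP => j; rewrite mxE derive_val.
- move=> t; apply: sin_neq0_notZ; exact: sin_slab_neq0 (wI t).
- exists (torus_proj (pt x0 y0 b)); have [Zb Xb] := Zend b hb; split => //.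
  exact: torus_proj_cvg.
- exists (torus_proj (pt x0 y0 b')); have [Zb Xb] := Zend b' hb'; split => //.
  exact: torus_proj_cvg.
Qed.

Theorem proposition4p15 (R : realType) (X : vfield R)
  (hBeltrami : b_Beltrami X)
  (hsym : globally_symmetric X)
  (hnz : exists p : torus3 R, Zhyp p /\ X p <> 0%R) :
  exists gamma1 gamma2 : R -> torus3 R,
    [/\ singular_periodic_orbit X gamma1,
        singular_periodic_orbit X gamma2 &
        range gamma1 <> range gamma2].
Proof.
have [g1 [orb1 z1]] := slab_orbit hBeltrami hsym hnz (or_introl erefl).
have [g2 [orb2 z2]] := slab_orbit hBeltrami hsym hnz (or_intror erefl).
exists g1, g2; split => // g12.
(* A common point would have a height with sin > 0 and one with sin < 0. *)
have [t _ gt0] : range g2 (g1 0) by rewrite -g12; exists 0.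
have [b /andP[b1 b2] eb] := z1 0; have [b' /andP[b1' b2'] eb'] := z2 t.
have sb : 0 < sin b by apply: sin_gt0_pi; rewrite b1 -[pi]add0r.
have sb' : sin b' < 0.
  rewrite -[b'](subrK pi) sinDpi oppr_lt0 sin_gt0_pi//.
  by apply/andP; split; lra.
have : angle b = angle b' by rewrite -eb -eb' gt0.
by move=> /sin_angle sbb; move: sb; rewrite sbb ltNge ltW.
Qed.
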